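(* Let $\mathcal{G}=(\mathbb{V},\mathbb{E})$ be a finite digraph containing a globally reachable node, with out-Laplacian $L_o=B_oE^\top$. Then $L_o$ and $L_o^\top$ have the same kernel, $\ker(L_o)=\ker(L_o^\top)$, if and only if $\mathcal{G}$ is balanced.
   Context: A digraph $\mathcal{G}=(\mathbb{V},\mathbb{E})$ has finite vertex set $\mathbb{V}$ and edge set $\mathbb{E}\subset\mathbb{V}\times\mathbb{V}$; an edge $(i,j)$ is directed from $i$ to $j$. The out-incidence matrix $B_o\in\mathbb{R}^{|\mathbb{V}|\times|\mathbb{E}|}$ has $[B_o]_{ik}=1$ if edge $e_k$ leaves $i$ and $0$ otherwise; the in-incidence matrix $B_i\in\mathbb{R}^{|\mathbb{V}|\times|\mathbb{E}|}$ has $[B_i]_{jk}=-1$ if edge $e_k$ enters $j$ and $0$ otherwise; the incidence matrix is $E=B_o+B_i$. The out-Laplacian is $L_o=B_oE^\top$. A node is globally reachable if it can be reached from every other node by a directed walk (a sequence of nodes with a directed edge from each node to the next). The digraph is balanced if in-degree equals out-degree at every node. *)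

(* Defs.v *)
From mathcomp Require Import all_boot all_order all_algebra.

Set Implicit Arguments.
Unset Strict Implicit.
Unset Printing Implicit Defensive.

Import GRing.Theory.
Local Open Scope ring_scope.

(* A digraph on the finite vertex type V is its edge set E : {set V * V};
   (u, v) \in E is an edge from u to v.  Self-loops are allowed. *)

Definition adj (V : finType) (E : {set V * V}) : rel V :=
  fun u v => (u, v) \in E.

Definition globally_reachable (V : finType) (E : {set V * V}) (v : V) : Prop :=
  forall u : V, u != v -> connect (adj E) u v.

Definition out_degree (V : finType) (E : {set V * V}) (v : V) : nat :=
  #|[set e in E | e.1 == v]|.

Definition in_degree (V : finType) (E : {set V * V}) (v : V) : nat :=
  #|[set e in E | e.2 == v]|.

Definition balanced (V : finType) (E : {set V * V}) : Prop :=
  forall v : V, in_degree E v = out_degree E v.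

(* Rows and columns follow the library's enumerations of V and E: row i stands
   for the vertex enum_val i and column k for the edge enum_val k. *)

Definition out_incidence (R : pzRingType) (V : finType) (E : {set V * V}) :
    'M[R]_(#|V|, #|E|) :=
  \matrix_(i < #|V|, k < #|E|)
    (if (enum_val k).1 == enum_val i then 1 else 0).

Definition in_incidence (R : pzRingType) (V : finType) (E : {set V * V}) :
    'M[R]_(#|V|, #|E|) :=
  \matrix_(i < #|V|, k < #|E|)
    (if (enum_val k).2 == enum_val i then -1 else 0).

Definition incidence (R : pzRingType) (V : finType) (E : {set V * V}) :
    'M[R]_(#|V|, #|E|) :=
  out_incidence R E + in_incidence R E.

Definition out_laplacian (R : pzRingType) (V : finType) (E : {set V * V}) :
    'M[R]_#|V| :=
  out_incidence R E *m (incidence R E)^T.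

(* The kernel of A acting on column vectors; kermx is the kernel of the action
   on row vectors. *)
Definition colker (F : fieldType) (m n : nat) (A : 'M[F]_(m, n)) :
    {vspace 'cV[F]_n} :=
  lker (linfun (mulmx A : 'cV[F]_n -> 'cV[F]_m)).

Lemma mem_colker (F : fieldType) (m n : nat) (A : 'M[F]_(m, n)) (x : 'cV[F]_n) :
  (x \in colker A) = (A *m x == 0).
Proof. by rewrite memv_ker lfunE. Qed.

(* Main.v *)
(* The constant vector 1 lies in the kernel of L_o, and L_o^T 1 is the vector
   of differences between out- and in-degrees, so equal kernels force balance.
   Conversely, in a balanced digraph the quadratic form of L_o (hence also that
   of L_o^T) is half the sum over the edges (u, v) of (x_u - x_v)^2.  A vector
   in either kernel is thus constant along edges, so by reachability constant,
   and the constant vectors lie in both kernels. *)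

Require Import Defs.
From mathcomp Require Import all_boot all_order all_algebra.
From mathcomp Require Import ring.

Set Implicit Arguments.
Unset Strict Implicit.
Unset Printing Implicit Defensive.

Import Order.TTheory GRing.Theory Num.Theory.
Local Open Scope ring_scope.

(** Group the edges by source. Together with its counterpart for targets, this makes the sum of
    [g e.1 - g e.2] over the edges vanish in a balanced digraph. *)
Lemma sum_out_degree (M : nmodType) (V : finType) (E : {set V * V})
    (g : V -> M) :
  \sum_(e in E) g e.1 = \sum_v g v *+ out_degree E v.
Proof.
rewrite (partition_big fst predT) //=; apply: eq_bigr => v _.
rewrite (eq_bigr (fun=> g v)) => [|e /andP[_ /eqP ->] //].
by rewrite sumr_const /out_degree cardsE.
Qed.

Lemma sum_in_degree (M : nmodType) (V : finType) (E : {set V * V})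
    (g : V -> M) :
  \sum_(e in E) g e.2 = \sum_v g v *+ in_degree E v.
Proof.
rewrite (partition_big snd predT) //=; apply: eq_bigr => v _.
rewrite (eq_bigr (fun=> g v)) => [|e /andP[_ /eqP ->] //].
by rewrite sumr_const /in_degree cardsE.
Qed.

Section Incidence.

Variables (R : comNzRingType) (V : finType) (E : {set V * V}).

Lemma out_incidence_trmx_mul (x : 'cV[R]_#|V|) k :
  ((out_incidence R E)^T *m x) k 0 = x (enum_rank (enum_val k).1) 0.
Proof.
rewrite mxE (bigD1 (enum_rank (enum_val k).1)) //= big1 => [|i ne_i].
  by rewrite !mxE enum_rankK eqxx mul1r addr0.
by rewrite !mxE -(can2_eq enum_rankK enum_valK) eq_sym (negPf ne_i) mul0r.
Qed.

Lemma in_incidence_trmx_mul (x : 'cV[R]_#|V|) k :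
  ((in_incidence R E)^T *m x) k 0 = - x (enum_rank (enum_val k).2) 0.
Proof.
rewrite mxE (bigD1 (enum_rank (enum_val k).2)) //= big1 => [|i ne_i].
  by rewrite !mxE enum_rankK eqxx mulN1r addr0.
by rewrite !mxE -(can2_eq enum_rankK enum_valK) eq_sym (negPf ne_i) mul0r.
Qed.

Lemma incidence_trmx_mul (x : 'cV[R]_#|V|) k :
  ((incidence R E)^T *m x) k 0 =
  x (enum_rank (enum_val k).1) 0 - x (enum_rank (enum_val k).2) 0.
Proof.
rewrite /incidence linearD /= mulmxDl mxE.
by rewrite out_incidence_trmx_mul in_incidence_trmx_mul.
Qed.

Lemma out_laplacian_const c : out_laplacian R E *m (const_mx c : 'cV_#|V|) = 0.
Proof.
rewrite -mulmxA (_ : _^T *m _ = 0) ?mulmx0 //.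
by apply/colP => k; rewrite incidence_trmx_mul !mxE subrr.
Qed.

(** The transpose factors as the incidence matrix times $B_o^\top$. Each edge has exactly one
    source, so $B_o^\top$ sends a constant vector on vertices to the same constant on edges; what
    remains is a row sum of the incidence matrix. *)
Lemma trmx_out_laplacian_const c (i : 'I_#|V|) :
  ((out_laplacian R E)^T *m (const_mx c : 'cV_#|V|)) i 0 =
  c *+ out_degree E (enum_val i) - c *+ in_degree E (enum_val i).
Proof.
rewrite trmx_mul trmxK -mulmxA (_ : _^T *m _ = const_mx c); last first.
  by apply/colP => k; rewrite out_incidence_trmx_mul !mxE.
have degE (d : pred (V * V)) :
    c *+ #|[set e in E | d e]| = \sum_(k < #|E|) if d (enum_val k) then c else 0.
  rewrite -(big_enum_val (fun e => if d e then c else 0)) -big_mkcondr /=.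
  by rewrite sumr_const cardsE.
rewrite mxE !degE -sumrB; apply: eq_bigr => k _; rewrite !mxE mulrDl.
by congr (_ + _); case: ifP => _; rewrite ?mul1r ?mulN1r ?mul0r ?oppr0.
Qed.

Lemma out_laplacian_form (x : 'cV[R]_#|V|) :
  (x^T *m out_laplacian R E *m x) 0 0 =
  \sum_(e in E) x (enum_rank e.1) 0 *
    (x (enum_rank e.1) 0 - x (enum_rank e.2) 0).
Proof.
(* Regroup as $(B_o^\top x)^\top (E^\top x)$, a dot product indexed by the edges. *)
rewrite /out_laplacian mulmxA -mulmxA -[x^T *m _]trmxK trmx_mul trmxK mxE.
rewrite [RHS]big_enum_val /=; apply: eq_bigr => k _.
by rewrite mxE out_incidence_trmx_mul incidence_trmx_mul.
Qed.

Lemma out_laplacian_form_balanced (x : 'cV[R]_#|V|) : balanced E ->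
  (x^T *m out_laplacian R E *m x) 0 0 *+ 2 =
  \sum_(e in E) (x (enum_rank e.1) 0 - x (enum_rank e.2) 0) ^+ 2.
Proof.
move=> balE; pose sq v := x (enum_rank v) 0 ^+ 2.
have sum_sq : \sum_(e in E) (sq e.1 - sq e.2) = 0.
  rewrite sumrB sum_out_degree sum_in_degree -sumrB big1 // => v _.
  by rewrite balE subrr.
(* Adding the vanishing [sum_sq] on the right reduces the claim to the edgewise identity $2a(a-b) =
   (a-b)^2 + (a^2-b^2)$. *)
rewrite out_laplacian_form -sumrMnl -[RHS]addr0 -[X in _ + X]sum_sq.
rewrite -big_split /=.
by apply: eq_bigr => e _; rewrite /sq; ring.
Qed.

End Incidence.

Lemma globally_reachable_const (T : Type) (V : finType) (E : {set V * V})
    (r : V) (f : V -> T) :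
    globally_reachable E r -> (forall e, e \in E -> f e.1 = f e.2) ->
  forall u, f u = f r.
Proof.
move=> reach_r f_edge u; have [-> // | /reach_r/connectP[p]] := eqVneq u r.
elim: p u => [|v p IHp] u /= => [_ -> // | /andP[/f_edge /= -> path_p]].
exact: IHp.
Qed.

Lemma out_laplacian_form_eq0_const (R : realFieldType) (V : finType)
    (E : {set V * V}) (r : V) (x : 'cV[R]_#|V|) :
    balanced E -> globally_reachable E r ->
    x^T *m out_laplacian R E *m x = 0 ->
  x = const_mx (x (enum_rank r) 0).
Proof.
move=> balE reach_r x0; apply/colP => i; rewrite mxE -[i]enum_valK.
apply: (globally_reachable_const (f := fun v => x (enum_rank v) 0) reach_r).
move=> e eE; have := out_laplacian_form_balanced x balE.
rewrite x0 mxE mul0rn => /esym/eqP.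
(* The order on [R] enters here: a zero sum of squares has only zero terms. *)
rewrite psumr_eq0 => [/allP/(_ e (mem_index_enum e))|e' _]; last exact: sqr_ge0.
by rewrite eE sqrf_eq0 subr_eq0 => /eqP.
Qed.

Theorem proposition3 (R : realFieldType) (V : finType) (E : {set V * V})
    (hreach : exists v : V, globally_reachable E v) :
  colker (out_laplacian R E) = colker (out_laplacian R E)^T <-> balanced E.
Proof.
split=> [eq_ker v | balE].
  have := mem_colker (out_laplacian R E)^T (const_mx 1).
  rewrite -eq_ker mem_colker out_laplacian_const eqxx => /esym/eqP/colP.
  move/(_ (enum_rank v)); rewrite trmx_out_laplacian_const enum_rankK mxE.
  (* Characteristic zero turns equality of the degrees in [R] into equality in [nat]. *)
  by move/subr0_eq/eqP; rewrite eqr_nat => /eqP.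
case: hreach => r reach_r.
have kerT_const c : (out_laplacian R E)^T *m (const_mx c : 'cV_#|V|) = 0.
  by apply/colP => i; rewrite trmx_out_laplacian_const balE subrr mxE.
apply/vspaceP => x; rewrite !mem_colker.
apply/eqP/eqP => Lx0.
  rewrite (out_laplacian_form_eq0_const (x := x) balE reach_r) //.
  by rewrite -mulmxA Lx0 mulmx0.
rewrite (out_laplacian_form_eq0_const (x := x) balE reach_r).
  exact: out_laplacian_const.
(* $x^\top L_o = (L_o^\top x)^\top = 0$, so the form of $L_o$ itself vanishes at $x$. *)
by rewrite -[x^T *m _]trmxK trmx_mul trmxK Lx0 trmx0 mul0mx.
Qed.
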